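(* Let $n\ge 1$ and let $\Omega_n=\mathbb{R}[x_1,\dots,x_n]\otimes\wedge\mathbb{R}^n$ be the algebra of polynomial differential forms on $\mathbb{R}^n$ (with $dx_1,\dots,dx_n$ the generators of the exterior factor), on which $S_n$ acts by permuting the indices of the $x_i$ and of the $dx_i$ simultaneously. For integers $r,s\ge 0$ let $H_{r,s}$ be the space of forms $\omega=\sum_{1\le i_1<\dots<i_s\le n}h_{i_1\dots i_s}\,dx_{i_1}\wedge\cdots\wedge dx_{i_s}$ such that every $h_{i_1\dots i_s}$ is an $S_n$-harmonic polynomial homogeneous of degree $r$ and $\delta_j\omega=0$ for $j=0,1,\dots,n-1$. Let $\chi_{r,s}$ be the character of $S_n$ on $H_{r,s}$. Then \[ \sum_{r,s}q^{r}t^{s}\,(\chi_{r,s},\mathrm{sgn})=\prod_{j=1}^{n-1}(q^{j}+t), \] i.e. $\sum_{r,s}q^rt^s\dim\{\omega\in H_{r,s}:\sigma\omega=\mathrm{sgn}(\sigma)\omega\ \forall\sigma\in S_n\}=\prod_{j=1}^{n-1}(q^j+t)$.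
   Context: A polynomial $f\in\mathbb{R}[x_1,\dots,x_n]$ is $S_n$-harmonic if $\sum_{i=1}^n\partial_i^k f=0$ for $k=1,\dots,n$, where $\partial_i=\partial/\partial x_i$. For $l\ge 0$ the operator $\delta_l$ on $\Omega_n$ is defined by $\delta_l\big(h\,dx_{i_1}\wedge\cdots\wedge dx_{i_k}\big)=\sum_{j=1}^n(\partial_j^l h)\,\iota(dx_j)(dx_{i_1}\wedge\cdots\wedge dx_{i_k})$, extended linearly, where for $i_1<\dots<i_k$, $\iota(dx_j)dx_{i_1}\wedge\cdots\wedge dx_{i_k}=0$ if $j\notin\{i_1,\dots,i_k\}$ and equals $(-1)^{r-1}dx_{i_1}\wedge\cdots\wedge\widehat{dx_{i_r}}\wedge\cdots\wedge dx_{i_k}$ if $j=i_r$. The space $\bigoplus_{r,s}H_{r,s}$ is the orthogonal complement (for the tensor product of the Fischer inner product on polynomials and the inner product making the $dx_{i_1}\wedge\cdots\wedge dx_{i_k}$, $i_1<\dots<i_k$, orthonormal) of the ideal of $\Omega_n$ generated by the homogeneous $S_n$-invariants of positive total degree (where $\deg x_i=\deg dx_i=1$). For class functions $f,g$ on $S_n$, $(f,g)=\frac1{n!}\sum_{x\in S_n}f(x)g(x)$; $\mathrm{sgn}$ is the sign character. *)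

(* Defs.v *)
From HB Require Import structures.
From mathcomp Require Import all_boot all_order all_algebra all_fingroup.
From mathcomp Require Import mpoly.
Set Implicit Arguments. Unset Strict Implicit. Unset Printing Implicit Defensive.
Import Order.TTheory GRing.Theory Num.Theory.
Local Open Scope ring_scope.

Section Forms.
Variables (R : realFieldType) (n : nat).

(* Polynomial differential forms Omega_n: a form is given by its coefficients
   h_I in the basis dx_I = dx_{i_1} /\ ... /\ dx_{i_k}, i_1 < ... < i_k,
   indexed by subsets I of {0,...,n-1}. *)
Definition form := {ffun {set 'I_n} -> {mpoly R[n]}}.

Definition mono_form (K : {set 'I_n}) (p : {mpoly R[n]}) : form :=
  [ffun J => if J == K then p else 0].

Definition Sn_harmonic (f : {mpoly R[n]}) : Prop :=
  forall k : nat, (1 <= k <= n)%N -> \sum_(i < n) iter k (mderiv i) f = 0.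

(* delta_l (h dx_I) = sum_j (d_j^l h) iota(dx_j) dx_I, where
   iota(dx_j) dx_I = (-1)^(r-1) dx_{I \ j} if j = i_r, i.e. r-1 = #{i in I | i < j}. *)
Definition delta (l : nat) (w : form) : form :=
  \sum_(I : {set 'I_n}) \sum_(j in I)
     mono_form (I :\ j)
       ((-1) ^+ #|[set i in I | (i < j)%N]| *: iter l (mderiv j) (w I)).

Definition inv_count (s : 'S_n) (I : {set 'I_n}) : nat :=
  #|[set p : 'I_n * 'I_n | [&& p.1 \in I, p.2 \in I, (p.1 < p.2)%N & (s p.2 < s p.1)%N]]|.

(* action of s on forms: the algebra automorphism with x_i |-> x_(s i),
   dx_i |-> dx_(s i).  It maps h dx_I to (-1)^(inv s I) (s.h) dx_(s I). *)
Definition act (s : 'S_n) (w : form) : form :=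
  \sum_(I : {set 'I_n})
     mono_form (s @: I) ((-1) ^+ inv_count s I *: msym s (w I)).

Definition H_rs (r s : nat) (w : form) : Prop :=
  (forall I : {set 'I_n}, #|I| != s -> w I = 0) /\
  (forall I : {set 'I_n}, w I \is r.-homog /\ Sn_harmonic (w I)) /\
  (forall j : nat, (j < n)%N -> delta j w = 0).

Definition H_rs_sgn (r s : nat) (w : form) : Prop :=
  H_rs r s w /\ forall sg : 'S_n, act sg w = ((-1) ^+ odd_perm sg) *: w.

End Forms.

Definition has_dim (R : fieldType) (V : lmodType R) (S : V -> Prop) (d : nat) : Prop :=
  exists v : 'I_d -> V,
    [/\ forall i, S (v i),
        (forall c : 'I_d -> R, \sum_(i < d) c i *: v i = 0 -> forall i, c i = 0)
      & (forall w, S w -> exists c : 'I_d -> R, w = \sum_(i < d) c i *: v i)].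

(* prod_{j=1}^{n-1} (q^j + t) as a polynomial in t with coefficients in Z[q] *)
Definition gen_poly (n : nat) : {poly {poly int}} :=
  \prod_(1 <= j < n) (('X^j)%:P + 'X).

(* Main.v *)
(* Let Delta be the Vandermonde polynomial and, for J = {j_1 < ... < j_s} a subset
   of {0, ..., n-1}, let w_J = d_{j_1} ... d_{j_s} Delta, where
   d_j (h dx_I) = sum_i (d_i^j h) dx_i /\ dx_I.  The w_J form a basis of the space of
   alternating s-forms with harmonic coefficients.  Indeed, let I have s elements.
   The coefficient h of dx_I in an alternating s-form is symmetric in the variables
   indexed by I and antisymmetric in the others; if it is harmonic, then it is
   determined by its restriction to x_i = 0 (i in I), because d_i^n h = 0 and
   sum_{i in I} d_i^a h = - sum_{i not in I} d_i^a h for a > 0.  This restriction is an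
   alternating polynomial with exponents < n, hence is given by one coefficient for
   each complement of an s-element set J', and that coefficient of w_J is nonzero
   exactly when J = J'.
   The anticommutator of delta_l and d_j is the operator sum_i d_i^(l+j), so
   delta_l w_J = 0 whenever 0 is not in J, while delta_0 w_J = n w_{J \ 0} if 0 is
   in J.  Thus the w_J with J contained in {1, ..., n-1} form the required basis, and
   w_J has polynomial degree sum_{j not in J} j. *)

Require Import Defs.
From HB Require Import structures.
From mathcomp Require Import all_boot all_order all_algebra all_fingroup.
From mathcomp Require Import mpoly ssrcomplements bigenough.
Import Order.TTheory GRing.Theory Num.Theory.
(* Makes act and form denote those of Defs, which the MathComp imports shadow. *)
Import BigEnough Defs.
Set Implicit Arguments. Unset Strict Implicit. Unset Printing Implicit Defensive.
Local Open Scope ring_scope.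

(** * Polynomials acting as constant-coefficient differential operators *)

Section DifferentialAction.
Variables (R : realFieldType) (n : nat).
Implicit Types (P Q f g : {mpoly R[n]}) (m : 'X_{1..n}) (i : 'I_n).

(** Encoding operators as polynomials turns the operator identities below into identities in the
    commutative ring [{mpoly R[n]}], through [dopM]. *)
Definition dop P f : {mpoly R[n]} := \sum_(m <- msupp P) P@_m *: f^`M[m].

(** Bounding the degree gives an index set independent of [P], so that linearity in [P] can be
    checked termwise. *)
Lemma dopwE k P f : (msize P <= k)%N ->
  dop P f = \sum_(m : 'X_{1..n < k}) P@_m *: f^`M[m].
Proof.
move=> le_Pk; rewrite /dop (big_mksub 'X_{1..n < k}) //=; first last.
- by move=> m /msize_mdeg_lt /leq_trans; apply.
- exact: msupp_uniq.
rewrite big_rmcond //= => m /memN_msupp_eq0 ->.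
by rewrite scale0r.
Qed.

Lemma dop_linear_l f : linear (fun P => dop P f).
Proof.
move=> c P Q; pose_big_enough k; first rewrite !(@dopwE k) //.
  rewrite scaler_sumr -big_split /=; apply: eq_bigr => m _.
  by rewrite mcoeffD mcoeffZ scalerDl scalerA.
by close.
Qed.

Lemma dopDl f P Q : dop (P + Q) f = dop P f + dop Q f.
Proof. by have := dop_linear_l f 1 P Q; rewrite !scale1r. Qed.

Lemma dop0l f : dop 0 f = 0.
Proof. by rewrite /dop msupp0 big_nil. Qed.

Lemma dopZl c P f : dop (c *: P) f = c *: dop P f.
Proof. by have := dop_linear_l f c P 0; rewrite !addr0 dop0l addr0. Qed.

Lemma dop_suml (I : Type) (r : seq I) (C : pred I) (F : I -> {mpoly R[n]}) f :
  dop (\sum_(i <- r | C i) F i) f = \sum_(i <- r | C i) dop (F i) f.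
Proof. by apply: (big_morph (dop^~ f)) => [P Q|]; [exact: dopDl|exact: dop0l]. Qed.

Lemma dop_linear_r P : linear (dop P).
Proof.
move=> c f g; rewrite /dop scaler_sumr -big_split /=; apply: eq_bigr => m _.
by rewrite linearP scalerDr !scalerA mulrC.
Qed.

HB.instance Definition _ P :=
  GRing.isLinear.Build R {mpoly R[n]} {mpoly R[n]} _ (dop P) (dop_linear_r P).

Lemma dopZr c P f : dop P (c *: f) = c *: dop P f.
Proof. exact: linearZ. Qed.

Lemma dop0r P : dop P 0 = 0.
Proof. exact: linear0. Qed.

Lemma dopX m f : dop 'X_[m] f = f^`M[m].
Proof. by rewrite /dop msuppX big_seq1 mcoeffX eqxx scale1r. Qed.

Lemma dop1 f : dop 1 f = f.
Proof. by rewrite -mpolyX0 dopX mderivm0m. Qed.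

Lemma dopXn i k f : dop ('X_i ^+ k) f = iter k (mderiv i) f.
Proof. by rewrite mpolyXn dopX mderivn_iter. Qed.

Lemma dopM P Q f : dop (P * Q) f = dop P (dop Q f).
Proof.
elim/mpolyind: P => [|c m P _ _ ihP]; first by rewrite mul0r !dop0l.
rewrite mulrDl !dopDl {}ihP; congr (_ + _); rewrite -scalerAl !dopZl dopX.
congr (_ *: _); elim/mpolyind: Q => [|d k Q _ _ ihQ].
  by rewrite mulr0 !dop0l linear0.
rewrite mulrDr !dopDl linearD /= {}ihQ; congr (_ + _).
by rewrite -scalerAr !dopZl linearZ /= -mpolyXD !dopX addmC mderivmDm.
Qed.

Lemma dopC P Q f : dop P (dop Q f) = dop Q (dop P f).
Proof. by rewrite -!dopM mulrC. Qed.

Definition mnm_fact m : nat := (\prod_(i < n) (m i)`!)%N.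

(** Coefficients become constant terms of derivatives, up to a factor that is nonzero in
    characteristic 0. This is how operator identities yield the vanishing of coefficients. *)
Lemma dopX_mcoeff0 m f : (dop 'X_[m] f)@_0%MM = f@_m *+ mnm_fact m.
Proof.
rewrite dopX mcoeff_mderivm addm0; congr (_ *+ _).
by apply: eq_bigr => i _; rewrite ffactnn.
Qed.

Lemma dopX_mcoeff0_eq0 m f : ((dop 'X_[m] f)@_0%MM == 0) = (f@_m == 0).
Proof.
rewrite dopX_mcoeff0 mulrn_eq0 /mnm_fact.
have /negPf -> // : (\prod_(i < n) (m i)`! != 0)%N.
by rewrite -lt0n prodn_gt0 // => i; rewrite fact_gt0.
Qed.

Lemma msym_dop (s : 'S_n) P f : msym s (dop P f) = dop (msym s P) (msym s f).
Proof.
elim/mpolyind: P => [|c m P _ _ ihP]; first by rewrite msym0 !dop0l msym0.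
rewrite dopDl !msymD dopDl ihP; congr (_ + _).
rewrite dopZl !msymZ dopZl msymX !dopX; congr (_ *: _).
apply/mpolyP => k; rewrite mcoeff_sym !mcoeff_mderivm mcoeff_sym.
congr (_@__ *+ _); first by apply/mnmP=> i; rewrite !(mnmE, mnmDE) permK.
rewrite [RHS](reindex_inj (@perm_inj _ s)) /=; apply: eq_bigr => i _.
by rewrite !(mnmE, mnmDE) permK.
Qed.

Lemma dop_homog d e P f : P \is d.-homog -> f \is e.-homog ->
  forall c, (c + d)%N = e -> dop P f \is c.-homog.
Proof.
move=> /dhomogP hP hf c cde; rewrite /dop big_seq; apply: rpred_sum => m mP.
apply: rpredZ; apply/dhomogP => k; rewrite mcoeff_msupp mcoeff_mderivm.
have [/eqP kc|kc] := boolP (mdeg k == c); first by [].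
rewrite (dhomog_nemf_coeff hf) ?mul0rn ?eqxx //=.
by rewrite mdegD (hP _ mP : mdeg m = d) -cde addnC eqn_add2r.
Qed.

Definition psum k : {mpoly R[n]} := \sum_(i < n) 'X_i ^+ k.

Lemma harmonicP f :
  Sn_harmonic f <-> forall k, (1 <= k <= n)%N -> dop (psum k) f = 0.
Proof.
suff e k : dop (psum k) f = \sum_(i < n) iter k (mderiv i) f.
  by split=> h k hk; have := h k hk; rewrite e.
by rewrite /psum dop_suml; apply: eq_bigr => i _; rewrite dopXn.
Qed.

Lemma deriv_prod (A : comNzRingType) (I : finType) (F : I -> {poly A}) :
  (\prod_i F i)^`() = \sum_i (F i)^`() * \prod_(j | j != i) F j.
Proof.
have : uniq (index_enum I) by exact: index_enum_uniq.
elim: (index_enum I) => [|i r ih] /=.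
  by rewrite !big_nil derivC.
case/andP=> ir ur; rewrite !big_cons derivM {}ih // eqxx; congr (_ * _ + _).
  by rewrite big_seq_cond [RHS]big_seq_cond; apply: eq_bigl => j;
     case: eqP => [->|]; rewrite ?andbT // (negPf ir).
rewrite mulr_sumr [LHS]big_seq [RHS]big_seq; apply: eq_bigr => j jr.
have ij : i != j by apply: contraNneq ir => ->.
by rewrite big_cons ij [LHS]mulrCA.
Qed.

(** * Newton's identities *)

Section Newton.
Variables (A : comNzRingType) (x : 'I_n -> A).
Let P := \prod_l (1 - x l *: 'X).
Let Q l := \prod_(l' | l' != l) (1 - x l' *: 'X).

Lemma coef0_rev_roots : P`_0 = 1.
Proof.
rewrite /P -horner_coef0 horner_prod big1 // => l _.
by rewrite !hornerE /= ?mulr0 ?subr0.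
Qed.

(** [P] is [Q l] times 1 - x_l X, and the inverse of that factor is the geometric series in x_l
    X. *)
Let coefQ l k : (Q l)`_k = \sum_(i < k.+1) x l ^+ i * P`_(k - i).
Proof.
have QE : Q l = P + x l *: ('X * Q l).
  by rewrite /P (bigD1 l) //= mulrBl mul1r scalerAl subrK.
elim: k => [|k ih]; rewrite QE coefD coefZ coefXM /=.
  by rewrite big_ord_recl big_ord0 expr0 mul1r mulr0.
rewrite ih [RHS]big_ord_recl expr0 mul1r subn0 mulr_sumr; congr (_ + _).
by apply: eq_bigr => i _; rewrite mulrA -exprS.
Qed.

(** The coefficients of [P] are, up to sign, the elementary symmetric functions of the x_l. The
    identity compares coefficients in P' = - sum_l x_l Q_l. *)
Lemma newton k :
  P`_k.+1 *+ k.+1 = - \sum_(i < k.+1) (\sum_l x l ^+ i.+1) * P`_(k - i).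
Proof.
rewrite -coef_deriv deriv_prod coef_sum.
transitivity (- \sum_l x l * (Q l)`_k).
  rewrite -sumrN; apply: eq_bigr => l _.
  rewrite derivB derivZ derivX -polyC1 derivC sub0r mulNr coefN.
  by rewrite -scalerAl mul1r coefZ.
under eq_bigr do rewrite coefQ mulr_sumr.
rewrite exchange_big /=; congr (- _); apply: eq_bigr => i _.
by rewrite mulr_suml; apply: eq_bigr => l _; rewrite mulrA -exprS.
Qed.

(** The left side is the coefficient of X^n in [Q l], a product of n-1 factors of degree at most
    1. *)
Lemma newton_root l : \sum_(i < n.+1) x l ^+ i * P`_(n - i) = 0.
Proof.
rewrite -coefQ nth_default //.
have n0 : (0 < n)%N by apply: leq_ltn_trans (ltn_ord l).
apply: leq_trans (size_poly_prod_leq _ _) _.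
rewrite leq_subLR cardC1 card_ord; apply: (@leq_trans (n.-1 * 2).+1); last first.
  by rewrite -[in leqRHS](prednK n0) muln2 -addnn addnS.
rewrite ltnS -[in leqRHS](card_ord n) -(cardC1 l) -sum_nat_const.
apply: leq_sum => i _; apply: leq_trans (size_polyD _ _) _.
rewrite size_polyN size_poly1 geq_max /=.
by rewrite (leq_trans (size_scale_leq _ _)) ?size_polyX.
Qed.

End Newton.

(** By [newton], the elementary symmetric operators of positive degree kill [f] along with the power
    sums, so only the term d_i^n of [newton_root] remains. *)
Lemma harmonic_dopXn_n f i : Sn_harmonic f -> dop ('X_i ^+ n) f = 0.
Proof.
move=> /harmonicP hf; pose x (l : 'I_n) : {mpoly R[n]} := 'X_l.
pose P := \prod_l (1 - x l *: 'X).
have hP k : (k < n)%N -> dop P`_k.+1 f = 0.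
  (* The factor k+1 in Newton's identity is invertible in characteristic 0. *)
  move=> kn; suff /eqP : k.+1%:R *: dop P`_k.+1 f = 0.
    by rewrite scaler_eq0 pnatr_eq0 /= => /eqP.
  rewrite -dopZl scaler_nat newton -scaleN1r dopZl dop_suml big1 ?scaler0 // => l _.
  rewrite mulrC dopM; have := hf l.+1; rewrite /psum => ->; rewrite ?linear0 //.
  by rewrite /= (leq_trans (ltn_ord l)).
have := congr1 (dop^~ f) (newton_root x i); rewrite /= dop0l dop_suml.
rewrite big_ord_recr /= subnn coef0_rev_roots mulr1 big1 ?add0r // => l _.
have ln : (0 < n - l)%N by rewrite subn_gt0.
by rewrite dopM -(prednK ln) hP ?linear0 // prednK // leq_subr.
Qed.

(** For k > n, each d_i^k contains d_i^n. *)
Lemma harmonic_psum f k : (0 < k)%N -> Sn_harmonic f -> dop (psum k) f = 0.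
Proof.
move=> k0 hf; have [kn|nk] := leqP k n; first by move/harmonicP: hf => ->; rewrite ?k0.
rewrite /psum dop_suml big1 // => i _.
by rewrite -(subnK (ltnW nk)) exprD dopM harmonic_dopXn_n // linear0.
Qed.

End DifferentialAction.

(** * Alternating polynomials and the Vandermonde polynomial *)

Section Alternating.
Variables (R : realFieldType) (n : nat).
Implicit Types (f : {mpoly R[n]}) (m : 'X_{1..n}) (s : 'S_n).

Definition alternating f := forall s, msym s f = (-1) ^+ s *: f.

Lemma alternating_mcoeff f m s : alternating f ->
  f@_[multinom m (s i) | i < n] = (-1) ^+ s * f@_m.
Proof. by move=> alt; rewrite -mcoeff_sym alt mcoeffZ. Qed.

Lemma eq_opp_eq0 (x : R) : x = - x -> x = 0.
Proof.
move=> /eqP; rewrite -subr_eq0 opprK -mulr2n -mulr_natl mulf_eq0 pnatr_eq0.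
by move=> /eqP.
Qed.

Lemma mnm_tperm m i j : m i = m j -> [multinom m (tperm i j k) | k < n] = m.
Proof.
move=> eq_ij; apply/mnmP => k; rewrite mnmE.
by case: tpermP => [->|->|].
Qed.

(** The transposition of [i] and [j] fixes the monomial but changes the sign of its coefficient. *)
Lemma alternating_mcoeff_eq0 f m i j : alternating f ->
  i != j -> m i = m j -> f@_m = 0.
Proof.
move=> alt ij eq_ij; apply: eq_opp_eq0.
rewrite -[in LHS](mnm_tperm eq_ij) alternating_mcoeff // odd_tperm ij.
by rewrite expr1 mulN1r.
Qed.

Definition perm_mnm s : 'X_{1..n} := [multinom val (s i) | i < n].

Lemma perm_mnm_inj : injective perm_mnm.
Proof.
move=> s t /mnmP est; apply/permP => i; apply/val_inj.
by have := est i; rewrite !mnmE.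
Qed.

Lemma perm_mnmM s t : perm_mnm (s * t)%g = [multinom perm_mnm t (s i) | i < n].
Proof. by apply/mnmP => i; rewrite !mnmE permM. Qed.

Lemma perm_mnmP m : (forall i, m i < n)%N -> injective m ->
  exists s, m = perm_mnm s.
Proof.
move=> m_lt m_inj; pose g i := Ordinal (m_lt i).
have g_inj : injective g by move=> i j [] /m_inj.
by exists (perm g_inj); apply/mnmP => i; rewrite mnmE permE.
Qed.

Lemma mdeg_perm_mnm s : mdeg (perm_mnm s) = (\sum_(i < n) i)%N.
Proof.
rewrite mdegE [RHS](reindex_inj (@perm_inj _ s)).
by apply: eq_bigr => i _; rewrite mnmE.
Qed.

(** The Leibniz expansion of det(x_i^j), which displays every coefficient. *)
Definition vandermonde : {mpoly R[n]} :=
  \sum_(s : 'S_n) (-1) ^+ s *: 'X_[perm_mnm s].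

Lemma vandermonde_perm s : vandermonde@_(perm_mnm s) = (-1) ^+ s.
Proof.
rewrite /vandermonde raddf_sum (bigD1 s) //= mcoeffZ mcoeffX eqxx mulr1.
rewrite big1 ?addr0 // => t ts.
by rewrite mcoeffZ mcoeffX (inj_eq perm_mnm_inj) (negPf ts) mulr0.
Qed.

Lemma vandermonde_supp m : vandermonde@_m != 0 -> exists s, m = perm_mnm s.
Proof.
move=> m0; suff /existsP[s /eqP ->] : [exists s, m == perm_mnm s] by exists s.
apply: contraNT m0; rewrite negb_exists => /forallP ne.
rewrite /vandermonde raddf_sum big1 //= => s _.
by rewrite mcoeffZ mcoeffX eq_sym (negPf (ne s)) mulr0.
Qed.

Lemma vandermonde_alternating : alternating vandermonde.
Proof.
move=> s; apply/mpolyP => m; rewrite mcoeff_sym mcoeffZ /vandermonde !raddf_sum.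
rewrite mulr_sumr (reindex_inj (mulgI s)) /=; apply: eq_bigr => t _.
rewrite !mcoeffZ !mcoeffX odd_permM signr_addb mulrA perm_mnmM; congr (_ * _%:R).
by congr (nat_of_bool _); rewrite (inj_eq (mperm_inj (s := s))).
Qed.

Lemma vandermonde_homog : vandermonde \is (\sum_(i < n) i)%N.-homog.
Proof.
by apply: rpred_sum => s _; rewrite rpredZ // dhomogX /= mdeg_perm_mnm.
Qed.

Lemma msym_psum k s : msym s (psum R n k) = psum R n k.
Proof.
rewrite /psum raddf_sum [RHS](reindex_inj (@perm_inj _ s)) /=.
apply: eq_bigr => i _; rewrite rmorphXn /=; congr (_ ^+ _).
by rewrite /msym mmapX mmap1U.
Qed.

Lemma dop_alternating k f : alternating f -> alternating (dop (psum R n k) f).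
Proof. by move=> alt s; rewrite msym_dop msym_psum alt linearZ. Qed.

(* A monomial m in p_k(d) Delta has distinct exponents, and m + k e_i is a
   permutation of 0, ..., n-1 for some i; so m itself is such a permutation,
   which contradicts the degrees. *)
Lemma vandermonde_harmonic : Sn_harmonic vandermonde.
Proof.
apply/harmonicP => k /andP[k0 kn]; apply/mpolyP => m; rewrite mcoeff0.
apply/eqP; apply: contraTT isT => m0.
have m_inj : injective m.
  move=> i j eq_ij; apply/eqP; apply: contraNT m0 => ij.
  rewrite (alternating_mcoeff_eq0 _ ij eq_ij) //.
  exact/dop_alternating/vandermonde_alternating.
have [i mi] : exists i, vandermonde@_(U_(i) *+ k + m) != 0.
  apply/existsP; apply: contraNT m0; rewrite negb_exists => /forallP ne.
  rewrite /psum dop_suml raddf_sum big1 //= => i _.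
  rewrite mpolyXn dopX mcoeff_mderivm.
  by have := ne i; rewrite negbK => /eqP ->; rewrite mul0rn.
have [s ms] := vandermonde_supp mi.
have m_lt j : (m j < n)%N.
  apply: leq_ltn_trans (ltn_ord (s j)).
  by have /mnmP/(_ j) := ms; rewrite mnmDE [perm_mnm s j]mnmE => <-; rewrite leq_addl.
have [t mt] := perm_mnmP m_lt m_inj.
have := congr1 (@mdeg n) ms; rewrite mdegD mt !mdeg_perm_mnm mdegMn mdeg1 mul1n.
move/eqP; rewrite -[X in _ == X]add0n eqn_add2r => /eqP k00.
by rewrite k00 in k0.
Qed.

End Alternating.

(** * Determinants of powers *)

Section PowerDet.
Variables (A : comNzRingType) (T : Type).
Implicit Types (x : T -> A) (s : nat) (u : nat -> T) (v : nat -> nat).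

(** Rows and exponents are indexed by [nat], so that deleting the first row and a column is
    composition with [S] and [bump b]. *)
Definition powdet x s u v : A := \det (\matrix_(a < s, b < s) x (u a) ^+ v b).

Lemma powdet_perm x s u u' v (p : 'S_s) : (forall a : 'I_s, u a = u' (p a)) ->
  powdet x s u v = (-1) ^+ p * powdet x s u' v.
Proof.
move=> uu'; rewrite /powdet -det_perm -det_mulmx -row_permE; congr (\det _).
by apply/matrixP => a b; rewrite !mxE uu'.
Qed.

Lemma powdetE x s u v : powdet x s u v =
  \sum_(p : 'S_s) (-1) ^+ p * \prod_(a < s) x (u a) ^+ v (p a).
Proof. by apply: eq_bigr => p _; congr (_ * _); apply: eq_bigr => a _; rewrite mxE. Qed.

Lemma powdet_expand x s u v : powdet x s.+1 u v =
  \sum_(b < s.+1) (-1) ^+ b * x (u 0%N) ^+ v b *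
     powdet x s (u \o S) (v \o bump b).
Proof.
rewrite /powdet (expand_det_row _ ord0); apply: eq_bigr => b _.
rewrite mxE /cofactor add0n mulrCA mulrA; congr (_ * \det _).
by apply/matrixP => i j; rewrite !mxE.
Qed.

End PowerDet.

(** * Signs of sorting *)

Section Signs.
Variables (n' : nat).
Local Notation n := n'.+1.
Implicit Types (I J K : {set 'I_n}) (u : nat -> 'I_n).

Definition elt I (a : nat) : 'I_n := nth ord0 (enum I) a.

Lemma mem_elt I (a : nat) : (a < #|I|)%N -> elt I a \in I.
Proof. by move=> aI; rewrite -mem_enum mem_nth // -cardE. Qed.

Lemma elt_index I i : i \in I -> exists a : 'I_#|I|, elt I a = i.
Proof.
rewrite -mem_enum => iI; have lt : (index i (enum I) < #|I|)%N.
  by rewrite cardE index_mem.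
by exists (Ordinal lt); rewrite /elt nth_index.
Qed.

Lemma elt_lt I (a b : nat) : (a < b < #|I|)%N -> (elt I a < elt I b)%N.
Proof.
move=> /andP[ab bI].
have tr : transitive (relpre val ltn : rel 'I_n) by move=> y x z; apply: ltn_trans.
have srt : sorted (relpre val ltn) (enum I).
  rewrite /enum_mem sorted_filter // -sorted_map -enumT val_enum_ord.
  exact: iota_ltn_sorted.
by apply: (sorted_ltn_nth tr) => //; rewrite inE -cardE // (ltn_trans ab).
Qed.

Lemma elt_inj I : {in gtn #|I| &, injective (elt I)}.
Proof.
move=> a b aI bI /eqP; rewrite nth_uniq ?enum_uniq -?cardE // => /eqP.
by [].
Qed.

(** The sign of the permutation that sorts the first [s] values of [u], or 0 if they repeat. It is
    the common form of the signs in [act] and [delta]. *)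
Definition sorting_sign s u : int :=
  \prod_(a < s) \prod_(b < s | (a < b)%N) sgz ((u b)%:Z - (u a)%:Z).

Let V s u := powdet (fun i : 'I_n => (i : nat)%:Z) s u id.

(** Seen as the sign of an integer determinant, [sorting_sign] is multiplied by the sign of a
    permutation when the rows are permuted. *)
Lemma sgz_powdet s u : sgz (V s u) = sorting_sign s u.
Proof.
rewrite /V /powdet -det_tr.
have -> : (\matrix_(a < s, b < s) ((u a : nat)%:Z ^+ b))^T =
   Vandermonde s (\row_(a < s) (u a : nat)%:Z).
  by apply/matrixP => a b; rewrite !mxE.
rewrite det_Vandermonde (big_morph (@sgz int) (@sgzM _) (sgz1 _)); apply: eq_bigr => a _.
rewrite (big_morph (@sgz int) (@sgzM _) (sgz1 _)); apply: eq_bigr => b _.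
by rewrite !mxE.
Qed.

Lemma sorting_sign_elt I : sorting_sign #|I| (elt I) = 1.
Proof.
rewrite /sorting_sign big1 // => a _; rewrite big1 // => b ab.
by apply/gtr0_sgz; rewrite subr_gt0 ltz_nat elt_lt // ab /=.
Qed.

Lemma sorting_sign_perm I u (p : 'S_#|I|) :
  (forall a : 'I_#|I|, u a = elt I (p a)) -> sorting_sign #|I| u = (-1) ^+ p.
Proof.
move=> pE; rewrite -sgz_powdet /V (powdet_perm _ _ pE) sgzM -/(V _ _) sgz_powdet.
by rewrite sorting_sign_elt mulr1; case: odd_perm; rewrite ?sgz1 // expr1 sgzN1.
Qed.

Lemma sorting_perm s u I : #|I| = s -> {in gtn s &, injective u} ->
  (forall a, (a < s)%N -> u a \in I) ->
  exists2 p : 'S_s, (forall a : 'I_s, u a = elt I (p a)) &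
    ((-1) ^+ p = sorting_sign s u).
Proof.
move=> sI u_inj uI; subst s.
have /fin_all_exists[g gE] (a : 'I_#|I|) := elt_index (uI a (ltn_ord a)).
have g_inj : injective g.
  by move=> a b gab; apply/val_inj/u_inj; rewrite ?inE ?ltn_ord // -[LHS]gE gab gE.
have pE (a : 'I_#|I|) : u a = elt I (perm g_inj a) by rewrite permE gE.
by exists (perm g_inj) => //; rewrite (sorting_sign_perm pE).
Qed.

Lemma powdet_sort (A : comNzRingType) (x : 'I_n -> A) s u v I :
  #|I| = s -> {in gtn s &, injective u} -> (forall a, (a < s)%N -> u a \in I) ->
  powdet x s u v = (sorting_sign s u)%:~R * powdet x s (elt I) v.
Proof.
move=> sI u_inj uI; have [p pE <-] := sorting_perm sI u_inj uI.
by rewrite (powdet_perm _ _ pE) rmorph_sign.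
Qed.

Lemma big_elt (A : Type) (idx : A) (op : Monoid.com_law idx) I (F : 'I_n -> A) :
  \big[op/idx]_(i in I) F i = \big[op/idx]_(a < #|I|) F (elt I a).
Proof.
by rewrite -big_enum /= (big_nth ord0) -cardE big_mkord.
Qed.

Lemma prod_signE (A : comNzRingType) (T : finType) (P Q : pred T) :
  \prod_(i | P i) (if Q i then -1 else 1 : A) = (-1) ^+ #|[set i | P i && Q i]|.
Proof.
by rewrite -big_mkcondr /= prodr_const; congr (_ ^+ _); apply: eq_card => i; rewrite inE.
Qed.

Lemma inv_count_sorting_sign (sg : 'S_n) I :
  (-1) ^+ inv_count sg I = sorting_sign #|I| (sg \o elt I).
Proof.
rewrite /sorting_sign /inv_count.
(* The value 1 on pairs that are not increasing allows products over all pairs in [I]; the factors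
   -1 are those of the inversions. *)
pose F (i j : 'I_n) : int := if (i < j)%N then
  sgz ((sg j : nat)%:Z - (sg i : nat)%:Z) else 1.
transitivity (\prod_(a < #|I|) \prod_(j in I) F (elt I a) j); last first.
  apply: eq_bigr => a _; rewrite big_elt [RHS]big_mkcond /=.
  apply: eq_bigr => b _; rewrite /F; case: (ltngtP a b) => ab.
  - by rewrite elt_lt // ab /=.
  - by rewrite ltnNge ltnW // elt_lt // ab /=.
  - by rewrite ab ltnn.
rewrite -(big_elt _ I (fun i => \prod_(j in I) F i j)) pair_big /=.
have -> : [set p | [&& p.1 \in I, p.2 \in I, (p.1 < p.2)%N & (sg p.2 < sg p.1)%N]]
  = [set p | (p.1 \in I) && (p.2 \in I) && ((p.1 < p.2)%N && (sg p.2 < sg p.1)%N)].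
  by apply/setP => p; rewrite !inE andbA.
rewrite -prod_signE; apply: eq_bigr => -[i j] /= _; rewrite /F.
case: ltngtP => //= ij.
case: (ltngtP (sg j) (sg i)) => sij.
- by rewrite ltr0_sgz // subr_lt0 ltz_nat.
- by rewrite gtr0_sgz // subr_gt0 ltz_nat.
by rewrite -(perm_inj (val_inj sij)) ltnn in ij.
Qed.

(** [elt K] is increasing, so only comparisons with the leading [j] can contribute -1. *)
Lemma sorting_sign_cons j K : j \notin K ->
  (-1) ^+ #|[set i in K | (i < j)%N]| =
  sorting_sign #|K|.+1 (fun a => if a is a'.+1 then elt K a' else j).
Proof.
move=> jK; rewrite /sorting_sign big_ord_recl /= [X in _ * X]big1 ?mulr1; last first.
  move=> a _; rewrite big_mkcond big_ord_recl /= mul1r big1 // => b _.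
  case: ifP => // ab; apply/gtr0_sgz; rewrite subr_gt0 ltz_nat elt_lt //.
  by rewrite ltn_ord andbT.
rewrite big_mkcond big_ord_recl /= mul1r.
under [RHS]eq_bigr do rewrite add0n.
rewrite -(big_elt _ K (fun i : 'I_n => sgz ((i : nat)%:Z - (j : nat)%:Z))).
rewrite -prod_signE; apply: eq_bigr => i iK.
case: (ltngtP i j) => ij.
- by rewrite ltr0_sgz // subr_lt0 ltz_nat.
- by rewrite gtr0_sgz // subr_gt0 ltz_nat.
by rewrite -(val_inj ij) iK in jK.
Qed.

End Signs.

(** * The forms obtained from the Vandermonde polynomial *)

Section Forms.
Variables (R : realFieldType) (n' : nat).
Local Notation n := n'.+1.
Implicit Types (I J K : {set 'I_n}) (u : nat -> 'I_n) (w : form R n) (sg : 'S_n).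

Lemma actE sg w I :
  act sg w (sg @: I) = (-1) ^+ inv_count sg I *: msym sg (w I).
Proof.
rewrite /act sum_ffunE (bigD1 I) //= ffunE eqxx big1 ?addr0 // => K KI.
by rewrite ffunE (inj_eq (imset_inj (@perm_inj _ sg))) eq_sym (negPf KI).
Qed.

Lemma perm_imset_onto sg K : exists I, K = sg @: I.
Proof.
exists ((sg^-1)%g @: K); apply/setP => i.
by rewrite -[i in RHS](permKV sg) !mem_imset //; exact: perm_inj.
Qed.

(** Only the sets [j |: K] with [j] outside [K] contribute at [K]. *)
Lemma deltaE l w K : delta l w K =
  \sum_(j | j \notin K) (-1) ^+ #|[set i in K | (i < j)%N]| *:
     iter l (mderiv j) (w (j |: K)).
Proof.
rewrite /delta sum_ffunE.
under eq_bigr do rewrite sum_ffunE.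
under eq_bigr do under eq_bigr do rewrite ffunE.
rewrite (exchange_big_dep xpredT) //= [RHS]big_mkcond; apply: eq_bigr => j _.
have [jK|jK] := boolP (j \in K).
  rewrite big1 // => I jI; case: eqP => // KI.
  by rewrite KI !inE eqxx in jK.
rewrite (bigD1 (j |: K)) ?inE ?eqxx //= setU1K // eqxx big1 ?addr0.
  congr ((-1) ^+ _ *: _); apply: eq_card => i; rewrite !inE.
  by have [->|] := eqVneq i j; rewrite // ltnn !andbF.
move=> I /andP[jI ne]; case: eqP => // KI.
by rewrite KI setD1K // eqxx in ne.
Qed.

Local Notation X := (fun i : 'I_n => 'X_i : {mpoly R[n]}).
Local Notation Delta := (vandermonde R n).

(* The form w_J = d_{j_1} ... d_{j_s} Delta: expanding the product, its coefficient
   at dx_I is det(d_i^j)_{i in I, j in J} Delta. *)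
Definition diff_vandermonde J : form R n :=
  [ffun I : {set 'I_n} => if #|I| == #|J| then
     dop (powdet X #|J| (elt I) (fun b => elt J b)) Delta else 0].

Lemma msym_powdet sg s u v : msym sg (powdet X s u v) = powdet X s (sg \o u) v.
Proof.
rewrite !powdetE raddf_sum /=; apply: eq_bigr => p _.
rewrite rmorphM rmorph_sign rmorph_prod.
congr (_ * _); apply: eq_bigr => a _; rewrite rmorphXn /=; congr (_ ^+ _).
by rewrite /msym mmapX mmap1U.
Qed.

Lemma dop_signM k (P f : {mpoly R[n]}) : dop ((-1) ^+ k * P) f = (-1) ^+ k *: dop P f.
Proof.
rewrite -signr_odd -[in RHS]signr_odd; case: odd; rewrite ?mul1r ?scale1r //.
by rewrite mulN1r -scaleN1r dopZl.
Qed.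

(** Sorting [sg \o elt I] produces the sign that [act] carries, and the two cancel; what remains is
    the sign from the Vandermonde polynomial. *)
Lemma diff_vandermonde_act J sg :
  act sg (diff_vandermonde J) = (-1) ^+ sg *: diff_vandermonde J.
Proof.
apply/ffunP => K; have [I ->] := perm_imset_onto sg K.
rewrite actE !ffunE (card_imset _ (@perm_inj _ sg)).
have [IJ|_] := eqVneq #|I| #|J|; last by rewrite msym0 !scaler0.
rewrite msym_dop vandermonde_alternating linearZ /= msym_powdet.
rewrite (@powdet_sort _ _ _ _ _ _ (sg @: I)).
- rewrite -IJ -inv_count_sorting_sign rmorph_sign dop_signM 2!scalerA.
  by rewrite mulrAC -expr2 sqrr_sign mul1r.
- by rewrite card_imset //; exact: perm_inj.
- by move=> a b aI bI /perm_inj /elt_inj; apply; rewrite !inE IJ.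
- by move=> a aJ; rewrite mem_imset ?mem_elt ?IJ //; exact: perm_inj.
Qed.

Lemma diff_vandermonde_harmonic J I : Sn_harmonic (diff_vandermonde J I).
Proof.
apply/harmonicP => k kn; rewrite ffunE; case: ifP => _; last by rewrite linear0.
by rewrite dopC; have /harmonicP -> := @vandermonde_harmonic R n; rewrite ?linear0.
Qed.

Lemma powdet_homog s u v : powdet X s u v \is (\sum_(a < s) v a)%N.-homog.
Proof.
rewrite powdetE; apply: rpred_sum => p _; rewrite rpredMsign mprodXnE dhomogX /=.
rewrite mdeg_sum (reindex_inj (@perm_inj _ p^-1%g)) /=; apply/eqP/eq_bigr => a _.
by rewrite mdegMn mdeg1 mul1n permKV.
Qed.

Lemma diff_vandermonde_homog J I :
  diff_vandermonde J I \is (\sum_(j | j \notin J) j)%N.-homog.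
Proof.
rewrite ffunE; case: ifP => _; last exact: dhomog0.
apply: (dop_homog (powdet_homog _ _ _) (vandermonde_homog R n)).
rewrite -(big_elt addn J (fun j : 'I_n => j : nat)).
by rewrite addnC [RHS](bigID (mem J)).
Qed.

Lemma powdet_eq_row s u v (a b : nat) : (a < b < s)%N -> u a = u b ->
  powdet X s u v = 0.
Proof.
move=> /andP[ab bs] uab; have as_ := ltn_trans ab bs.
apply: (@determinant_alternate _ _ _ (Ordinal as_) (Ordinal bs)).
  by rewrite neq_ltn /= ab.
by move=> c; rewrite !mxE /= uab.
Qed.

(** The sign in [delta] is that of sorting [j] placed before [K], so [j] can be taken as first row
    of the determinant. Expanding along this row and summing over [j] produces power sums. *)
Lemma delta_diff_vandermonde l J K : #|K|.+1 = #|J| ->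
  delta l (diff_vandermonde J) K = \sum_(b < #|J|) (-1) ^+ b *:
    dop (powdet X #|K| (elt K) (fun c => elt J (bump b c)))
      (dop (psum R n (l + elt J b)) Delta).
Proof.
move=> KJ; rewrite deltaE.
pose u j a := if a is a'.+1 then elt K a' else j.
transitivity (\sum_j dop ('X_j ^+ l * powdet X #|K|.+1 (u j) (fun b => elt J b)) Delta).
  (* For [j] in [K] the determinant has a repeated row, so these terms can be added freely. *)
  rewrite [RHS](bigID (mem K)) /= [X in _ = X + _]big1 ?add0r.
    apply: eq_bigr => j jK; have cU : #|j |: K| = #|K|.+1 by rewrite cardsU1 jK.
    rewrite ffunE cU KJ eqxx -dopXn -KJ.
    rewrite (@powdet_sort _ _ _ _ (u j) _ (j |: K)).
    - by rewrite -sorting_sign_cons // rmorph_sign [RHS]dopM dop_signM dopZr.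
    - exact: cU.
    - move=> [|a] [|b]; rewrite !inE //= ?ltnS => aK bK.
      + by move=> jE; rewrite jE mem_elt in jK.
      + by move=> jE; rewrite -jE mem_elt in jK.
      + by move/elt_inj => ->.
    - by move=> [|a] aK /=; rewrite !inE ?eqxx // mem_elt ?orbT.
  move=> j jK; have [a aj] := elt_index jK.
  by rewrite (@powdet_eq_row _ _ _ 0%N a.+1) ?mulr0 ?dop0l //= ltnS.
rewrite -dop_suml -KJ.
under eq_bigr do rewrite powdet_expand mulr_sumr.
rewrite exchange_big dop_suml; apply: eq_bigr => b _.
under eq_bigr do rewrite !mulrA [_ * (-1) ^+ b]mulrC -!mulrA mulrA.
rewrite -dopM -dop_signM; congr (dop _ _).
rewrite /psum !mulr_sumr; apply: eq_bigr => i _.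
rewrite -[LHS]mulrA exprD; congr (_ * _); rewrite mulrA; exact: mulrC.
Qed.

Lemma delta_diff_vandermonde_out l J K :
  #|K|.+1 != #|J| -> delta l (diff_vandermonde J) K = 0.
Proof.
move=> KJ; rewrite deltaE big1 // => j jK.
by rewrite ffunE cardsU1 jK (negPf KJ) -dopXn dop0r scaler0.
Qed.

Lemma vandermonde_psum k : (0 < k)%N -> dop (psum R n k) Delta = 0.
Proof. by move=> k0; apply: harmonic_psum => //; exact: vandermonde_harmonic. Qed.

(** Every power sum that occurs has positive degree. *)
Lemma delta_diff_vandermonde_eq0 l J : ord0 \notin J ->
  delta l (diff_vandermonde J) = 0.
Proof.
move=> J0; apply/ffunP => K; rewrite [RHS]ffunE.
have [KJ|KJ] := eqVneq #|K|.+1 #|J|; last by rewrite delta_diff_vandermonde_out.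
rewrite delta_diff_vandermonde // big1 // => b _.
rewrite vandermonde_psum ?dop0r ?scaler0 // addn_gt0 orbC lt0n.
by apply/orP; left; apply: contraNneq J0 => /(@ord_inj _ _ ord0) <-; rewrite mem_elt.
Qed.

Lemma enum_ord0 J : ord0 \in J -> enum J = ord0 :: enum (J :\ ord0).
Proof.
move=> J0; rewrite /enum_mem -enumT enum_ordSl /= J0 !inE eqxx /= !filter_map.
by congr (_ :: map _ (map _ _)); apply: eq_filter => i; rewrite /= !inE.
Qed.

(** Only the power sum of degree 0 survives, and it equals n. *)
Lemma delta0_diff_vandermonde J : ord0 \in J ->
  delta 0 (diff_vandermonde J) = n%:R *: diff_vandermonde (J :\ ord0).
Proof.
move=> J0; apply/ffunP => K; rewrite !ffunE.
have JE : #|J| = #|J :\ ord0|.+1 by rewrite (cardsD1 ord0) J0.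
rewrite -eqSS -JE; have [KJ|KJ] := eqVneq #|K|.+1 #|J|; last first.
  by rewrite delta_diff_vandermonde_out // scaler0.
rewrite delta_diff_vandermonde // -KJ big_ord_recl [X in _ + X]big1 ?addr0.
  have -> : elt J (ord0 : 'I_#|K|.+1) = ord0 by rewrite /elt enum_ord0.
  have -> : psum R n (0 + (ord0 : 'I_n)) = n%:R *: 1.
    rewrite /psum; under eq_bigr do rewrite expr0.
    by rewrite sumr_const card_ord scaler_nat.
  rewrite expr0 scale1r dopZl dop1 dopZr.
  move: KJ; rewrite JE => -[KJ]; rewrite /elt (enum_ord0 J0) -KJ //.
move=> b _; rewrite vandermonde_psum ?dop0r ?scaler0 // add0n lift0.
have bJ : (0 < bump 0 b < #|J|)%N by rewrite -KJ /bump /= add1n !ltnS ltn_ord.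
exact: leq_ltn_trans (leq0n _) (elt_lt bJ).
Qed.

End Forms.

(** * Permutations with prescribed behaviour on a subset *)

Section Permutations.
Variable (n' : nat).
Local Notation n := n'.+1.
Implicit Types (I J : {set 'I_n}) (sg : 'S_n).

Lemma eltK I i : i \in I -> elt I (index i (enum I)) = i.
Proof. by move=> iI; rewrite /elt nth_index // mem_enum. Qed.

Lemma index_lt I i : i \in I -> (index i (enum I) < #|I|)%N.
Proof. by move=> iI; rewrite cardE index_mem mem_enum. Qed.

Lemma elt_ord_inj I : injective (fun a : 'I_#|I| => elt I a).
Proof. by move=> a b eab; apply/val_inj/(elt_inj _ _ eab); rewrite inE. Qed.

(** The complements of [I] and of its image have the same size and are matched in increasing
    order. *)
Lemma extend_perm (f : 'I_n -> 'I_n) I : {in I &, injective f} ->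
  exists sg, {in I, sg =1 f}.
Proof.
move=> f_inj; have cC : #|~: I| = #|~: (f @: I)|.
  apply/eqP; rewrite -(eqn_add2l #|I|) cardsC.
  by rewrite -[X in (X + _)%N](card_in_imset f_inj) cardsC.
pose g i := if i \in I then f i else elt (~: (f @: I)) (index i (enum (~: I))).
have gI i : i \notin I -> g i \notin f @: I.
  by move=> iI; rewrite /g (negPf iI) -in_setC mem_elt // -cC index_lt // inE.
have g_inj : injective g.
  move=> i j gij; have [iI|iI] := boolP (i \in I); have [jI|jI] := boolP (j \in I).
  - by apply: f_inj => //; move: gij; rewrite /g iI jI.
  - by have := gI j jI; rewrite -gij /g iI imset_f.
  - by have := gI i iI; rewrite gij /g jI imset_f.
  move: gij; rewrite /g (negPf iI) (negPf jI) => gij.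
  rewrite -in_setC in iI; rewrite -in_setC in jI; rewrite -(eltK iI) -(eltK jI); congr elt.
  by apply: (elt_inj _ _ gij); rewrite inE -cC index_lt.
by exists (perm g_inj) => i iI; rewrite permE /g iI.
Qed.

Lemma exists_perm_imset I J : #|I| = #|J| -> exists sg, sg @: I = J.
Proof.
move=> IJ; pose f i := elt J (index i (enum I)).
have f_inj : {in I &, injective f}.
  move=> i j iI jI fij; rewrite -(eltK iI) -(eltK jI); congr elt.
  by apply: (elt_inj _ _ fij); rewrite inE -IJ index_lt.
have [sg sgE] := extend_perm f_inj; exists sg.
apply/eqP; rewrite eqEcard card_imset ?IJ ?leqnn ?andbT; last exact: perm_inj.
apply/subsetP => j /imsetP[i iI ->].
by rewrite sgE // mem_elt // -IJ index_lt.
Qed.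

(** Lifting [p] one transposition at a time keeps track of the sign. *)
Lemma perm_block I (p : 'S_#|I|) : exists sg, [/\ odd_perm sg = odd_perm p,
  forall a : 'I_#|I|, sg (elt I a) = elt I (p a) & {in ~: I, sg =1 id}].
Proof.
have [ts -> dts] := prod_tpermP p.
elim: ts dts => [|t ts ih] /=.
  exists 1%g; rewrite big_nil; split=> [|a|i _]; rewrite ?odd_perm1 ?perm1 //.
case/andP=> dt /ih[sg [odd_sg sgI sgC]] {ih}.
have elt_neq : elt I t.1 != elt I t.2.
  by apply: contraNneq dt => /(@elt_ord_inj I) ->.
exists (tperm (elt I t.1) (elt I t.2) * sg)%g; rewrite big_cons; split.
- by rewrite !odd_permM !odd_tperm elt_neq dt odd_sg.
- move=> a; rewrite !permM -sgI; congr (sg _).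
  by rewrite -(inj_tperm _ _ _ (@elt_ord_inj I)).
- move=> i iI; rewrite permM tpermD ?sgC //.
    by apply: contraTneq iI => <-; rewrite inE negbK mem_elt.
  by apply: contraTneq iI => <-; rewrite inE negbK mem_elt.
Qed.

Lemma inv_count_fix sg I : {in I, sg =1 id} -> inv_count sg I = 0%N.
Proof.
move=> fixI; apply: eq_card0 => p; rewrite !inE.
apply/and4P => -[p1 p2]; rewrite !fixI // => lt12 /ltnW.
by rewrite leqNgt lt12.
Qed.

Lemma inv_count_tperm I i j : i \in I -> j \in I -> i != j ->
  odd (inv_count (tperm i j) I).
Proof.
move=> iI jI ij; have [a ai] := elt_index iI; have [b bj] := elt_index jI.
have ab : a != b by apply: contraNneq ij => ab; rewrite -ai ab bj.
suff : (-1) ^+ inv_count (tperm i j) I = -1 :> int by rewrite -signr_odd; case: odd.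
rewrite inv_count_sorting_sign (@sorting_sign_perm _ _ _ (tperm a b)).
  by rewrite odd_tperm ab.
by move=> c; rewrite /= -ai -bj -(inj_tperm _ _ _ (@elt_ord_inj I)).
Qed.

End Permutations.

(** * Alternating forms with harmonic coefficients *)

Section AlternatingForms.
Variables (R : realFieldType) (n' : nat).
Local Notation n := n'.+1.
Implicit Types (I J : {set 'I_n}) (sg : 'S_n) (w : form R n) (m : 'X_{1..n}).
Local Notation X := (fun i : 'I_n => 'X_i : {mpoly R[n]}).
Local Notation Delta := (vandermonde R n).

Definition alt_harmonic s w := [/\ forall I, #|I| != s -> w I = 0,
  forall I, Sn_harmonic (w I) & forall sg, act sg w = (-1) ^+ sg *: w].

Lemma alt_form_msym w I sg : (forall sg, act sg w = (-1) ^+ sg *: w) ->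
  msym sg (w I) = (-1) ^+ inv_count sg I *: ((-1) ^+ sg *: w (sg @: I)).
Proof.
move=> alt; have := actE sg w I; rewrite alt ffunE => ->.
by rewrite scalerA -expr2 sqrr_sign scale1r.
Qed.

(** A permutation fixing [I] pointwise has no inversions on [I], so the coefficient of dx_I is
    antisymmetric in the other variables. *)
Lemma alt_form_mcoeff_fix w I sg m : (forall sg, act sg w = (-1) ^+ sg *: w) ->
  {in I, sg =1 id} -> (w I)@_[multinom m (sg i) | i < n] = (-1) ^+ sg * (w I)@_m.
Proof.
move=> alt fixI; rewrite -mcoeff_sym alt_form_msym // inv_count_fix // scale1r mcoeffZ.
congr (_ * (w _)@__); rewrite -[RHS](imset_id I).
exact: eq_in_imset.
Qed.

(** A transposition inside [I] has an odd number of inversions there, which cancels its own sign. *)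
Lemma alt_form_mcoeff_tperm w I i j m : (forall sg, act sg w = (-1) ^+ sg *: w) ->
  i \in I -> j \in I -> (w I)@_[multinom m (tperm i j k) | k < n] = (w I)@_m.
Proof.
move=> alt iI jI; have [->|ij] := eqVneq i j.
  by congr (_@__); apply/mnmP => k; rewrite mnmE tperm1 perm1.
rewrite -mcoeff_sym alt_form_msym // !mcoeffZ odd_tperm ij.
rewrite -signr_odd inv_count_tperm // expr1 !mulN1r opprK; congr ((w _)@__).
apply/eqP; rewrite eqEcard card_imset ?leqnn ?andbT; last exact: perm_inj.
by apply/subsetP => k /imsetP[l lI ->]; case: tpermP => // ->.
Qed.

Lemma mnm_fact_perm sg m : mnm_fact [multinom m (sg i) | i < n] = mnm_fact m.
Proof.
rewrite /mnm_fact [RHS](reindex_inj (@perm_inj _ sg)).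
by apply: eq_bigr => i _; rewrite mnmE.
Qed.

(** These are monomials surviving the restriction x_i = 0 for i in [I]; their exponents outside [I]
    fill the complement of [sg @: I]. *)
Definition off_mnm I sg : 'X_{1..n} :=
  [multinom if i \in I then 0%N else sg i | i < n].

Definition off_coeff I sg w : R := (w I)@_(off_mnm I sg).

(* Induction on the number of variables indexed by I that occur in the monomial:
   on the symmetric harmonic polynomial w I, the sum of the d_i^a with i in I
   agrees up to sign with the sum of the d_i^a with i outside I. *)
Lemma alt_harmonic_coeff_eq0 s w I : alt_harmonic s w ->
  (forall m, {in I, forall i, m i = 0%N} -> (w I)@_m = 0) -> w I = 0.
Proof.
move=> [_ harm alt] hw; apply/mpolyP => m; rewrite mcoeff0.
have [k] := ubnP #|[set i in I | m i != 0%N]|; elim: k m => // k ih m.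
rewrite ltnS leq_eqVlt => /orP[/eqP mk|]; last exact: ih.
have [/eqP/setP m0|] := boolP ([set i in I | m i != 0%N] == set0).
  by apply: hw => i iI; have := m0 i; rewrite !inE iI => /negbFE/eqP.
case/set0Pn => i0; rewrite inE => /andP[i0I mi0].
pose a := m i0; pose m' : 'X_{1..n} := [multinom if i == i0 then 0%N else m i | i < n].
have mE : m = (m' + U_(i0) *+ a)%MM.
  apply/mnmP => i; rewrite mnmDE mulmnE mnm1E mnmE [i0 == i]eq_sym.
  by case: eqVneq => [->|_]; rewrite ?mul1n ?mul0n ?addn0.
pose c (P : {mpoly R[n]}) := (dop P (w I))@_0%MM.
(* If [i] is in [I] and absent from [m'], the monomial is a transposed copy of [m]. Otherwise it
   involves fewer variables of [I], and the induction hypothesis applies. *)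
have cX i : c 'X_[m' + U_(i) *+ a] =
    if (i \in I) && (m' i == 0%N) then c 'X_[m] else 0.
  case: ifP => [/andP[iI /eqP m'i]|/negbT iI].
    have m'i0 : m' i0 = 0%N by rewrite mnmE eqxx.
    have -> : (m' + U_(i) *+ a)%MM = [multinom m (tperm i0 i j) | j < n].
      apply/mnmP => j; rewrite mE mnmE !mnmDE !mulmnE !mnm1E.
      case: tpermP => [->|->|]; first by rewrite m'i0 m'i eq_sym.
        by rewrite m'i m'i0 !eqxx.
      by move=> /eqP/negPf j0 /eqP/negPf ji; rewrite ![_ == j]eq_sym j0 ji.
    by rewrite /c !dopX_mcoeff0 (alt_form_mcoeff_tperm _ alt) // mnm_fact_perm.
  apply/eqP; rewrite /c dopX_mcoeff0_eq0; apply/eqP/ih; rewrite -mk.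
  have m'j j : m' j != 0%N -> m j != 0%N by rewrite mnmE; case: (j == i0).
  apply: proper_card; apply/properP; split.
    apply/subsetP => j; rewrite !inE => /andP[jI].
    rewrite jI mnmDE mulmnE mnm1E; case: (eqVneq i j) => [ij|_]; last first.
      by rewrite mul0n addn0; exact: m'j.
    by move=> _; apply: m'j; move: iI; rewrite ij jI.
  exists i0; rewrite !inE ?i0I ?mi0 //= negbK mnmDE mulmnE mnm1E.
  have m'i0 : m' i0 = 0%N by rewrite mnmE eqxx.
  by case: (eqVneq i i0) iI => [->|_]; rewrite m'i0 ?i0I.
have : c ('X_[m'] * psum R n a) = 0.
  by rewrite /c dopM harmonic_psum ?dop0r ?mcoeff0 // lt0n.
rewrite /c mulr_sumr dop_suml raddf_sum /=.
under eq_bigr => i _ do rewrite mpolyXn -mpolyXD -/(c _) cX.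
(* A multiple of the coefficient at [m] vanishes, and the multiplicity is nonzero since it counts
   [i0]. *)
rewrite -big_mkcond sumr_const => /eqP; rewrite mulrn_eq0 => /orP[|].
  move=> /eqP/card0_eq/(_ i0).
  by rewrite -topredE /= i0I mnmE eqxx.
by rewrite /c dopX_mcoeff0_eq0 => /eqP.
Qed.

(** One permutation per image of [I] suffices: two with the same image give coefficients that agree
    up to sign. *)
Lemma alt_harmonic_off_coeff s w I : alt_harmonic s w ->
  (forall J, #|J| = #|I| -> exists2 sg : 'S_n, sg @: I = J & off_coeff I sg w = 0) ->
  w I = 0.
Proof.
move=> Hw hJ; apply: (alt_harmonic_coeff_eq0 Hw) => m mI.
have [_ harm alt] := Hw.
(* A monomial with an exponent at least n has coefficient 0, because d_i^n kills harmonic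
   polynomials. *)
have [/forallP m_lt|] := boolP [forall i, m i < n]%N; last first.
  case/forallPn => i; rewrite -leqNgt => mi; apply/eqP.
  have mE : m = (m - U_(i) *+ n + U_(i) *+ n)%MM.
    apply/esym/submK/mnm_lepP => j; rewrite mulmnE mnm1E.
    by case: eqVneq => [<-|]; rewrite ?mul1n.
  by rewrite -dopX_mcoeff0_eq0 mE mpolyXD -mpolyXn dopM harmonic_dopXn_n // dop0r mcoeff0.
pose f i := Ordinal (m_lt i).
(* Equal exponents outside [I] are excluded by antisymmetry. *)
have [/existsP[i /existsP[j /and4P[iI jI ij /eqP mij]]]|] :=
  boolP [exists i, [exists j, [&& i \notin I, j \notin I, i != j & m i == m j]]].
  apply: eq_opp_eq0; rewrite -[in LHS](mnm_tperm mij) alt_form_mcoeff_fix //.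
    by rewrite odd_tperm ij expr1 mulN1r.
  move=> k kI; rewrite tpermD //; first by apply: contraNneq iI => ->.
  by apply: contraNneq jI => ->.
rewrite negb_exists => /forallP m_inj.
have f_inj : {in ~: I &, injective f}.
  move=> i j; rewrite !inE => iI jI [mij]; have := m_inj i.
  rewrite negb_exists => /forallP/(_ j); rewrite iI jI mij eqxx andbT /= negbK.
  by move/eqP.
have [sg sgE] := extend_perm f_inj.
have [t tI t0] := hJ (sg @: I) (card_imset _ (@perm_inj _ sg)).
have tsI i : ((t^-1)%g (sg i) \in I) = (i \in I).
  rewrite -(mem_imset _ _ (@perm_inj _ t)) permKV tI mem_imset //; exact: perm_inj.
(* [g] fixes [I] pointwise and carries the exponents given by [t] to those of [m]. *)
pose g i := if i \in I then i else (t^-1)%g (sg i).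
have g_inj : injective g.
  move=> i j; rewrite /g.
  have [iI|iI] := boolP (i \in I); have [jI|jI] := boolP (j \in I) => // gij.
  - by rewrite gij tsI (negPf jI) in iI.
  - by rewrite -gij tsI (negPf iI) in jI.
  - exact: perm_inj (perm_inj gij).
have -> : m = [multinom off_mnm I t (perm g_inj i) | i < n].
  apply/mnmP => i; rewrite !mnmE permE /g.
  have [iI|iI] := boolP (i \in I); first by rewrite iI mI.
  by rewrite tsI (negPf iI) permKV sgE ?inE.
rewrite alt_form_mcoeff_fix //; first by rewrite [X in _ * X]t0 mulr0.
by move=> i iI; rewrite permE /g iI.
Qed.

End AlternatingForms.

(** * Evaluation of the determining coefficients on the basis forms *)

Section Diagonal.
Variables (R : realFieldType) (n' : nat).
Local Notation n := n'.+1.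
Implicit Types (I J : {set 'I_n}) (sg : 'S_n).
Local Notation Delta := (vandermonde R n).

Variables (I J : {set 'I_n}) (sg : 'S_n).
Hypothesis IJ : #|I| = #|J|.

(** The monomial that the Leibniz term of [p] differentiates down to a multiple of
    [off_mnm I sg]. *)
Let M (p : 'S_#|I|) : 'X_{1..n} :=
  (off_mnm I sg + \sum_(a < #|I|) U_(elt I a) *+ elt J (p a))%MM.

Let M_out p i : i \notin I -> M p i = sg i.
Proof.
move=> iI; rewrite mnmDE mnmE (negPf iI) mnm_sumE big1 ?addn0 // => a _.
rewrite mulmnE mnm1E; case: eqVneq => [ai|//].
by rewrite -ai mem_elt in iI.
Qed.

Let M_in p (a : 'I_#|I|) : M p (elt I a) = elt J (p a).
Proof.
rewrite mnmDE mnmE mem_elt // add0n mnm_sumE (bigD1 a) //= big1.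
  by rewrite addn0 mulmnE mnm1E eqxx mul1n.
move=> b ba; rewrite mulmnE mnm1E.
by rewrite (inj_eq (@elt_ord_inj _ I)) (negPf ba).
Qed.

Let off_coeff_sum : off_coeff I sg (diff_vandermonde R J) *+ mnm_fact (off_mnm I sg)
  = \sum_p (-1) ^+ odd_perm p * (Delta@_(M p) *+ mnm_fact (M p)).
Proof.
rewrite -dopX_mcoeff0 ffunE (introT eqP IJ) -dopM -IJ powdetE mulr_sumr dop_suml raddf_sum.
apply: eq_bigr => p _; rewrite mulrCA dop_signM mprodXnE -mpolyXD /= mcoeffZ.
by rewrite dopX_mcoeff0.
Qed.

Lemma off_coeff_diff_vandermonde_neq :
  sg @: I != J -> off_coeff I sg (diff_vandermonde R J) = 0.
Proof.
move=> neq.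
suff /eqP : off_coeff I sg (diff_vandermonde R J) *+ mnm_fact (off_mnm I sg) = 0.
  by rewrite -dopX_mcoeff0 dopX_mcoeff0_eq0 => /eqP.
rewrite off_coeff_sum big1 // => p _; rewrite [X in X *+ _](_ : _ = 0) ?mul0rn ?mulr0 //.
(* Some [j] in [J] is then an exponent both inside and outside [I], so [M p] has a repeated
   exponent. *)
have : ~~ (J \subset sg @: I).
  apply: contraNN neq => sub.
  by rewrite eq_sym eqEcard sub (card_imset _ (@perm_inj _ sg)) IJ leqnn.
case/subsetPn => j jJ jI; have [b bj] := elt_index jJ.
pose a := (p^-1)%g (cast_ord (esym IJ) b).
have i'I : (sg^-1)%g j \notin I.
  by apply: contra jI => iI; rewrite -(permKV sg j) imset_f.
apply: (@alternating_mcoeff_eq0 _ _ _ _ (elt I a) ((sg^-1)%g j)).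
- exact: vandermonde_alternating.
- by apply: contraNneq i'I => <-; rewrite mem_elt.
- by rewrite M_in M_out // permKV /a permKV /= bj.
Qed.

(** [M p] is [M 1] rearranged by a permutation of the same sign as [p]. The two signs cancel, so all
    Leibniz terms are equal and their sum is nonzero. *)
Lemma off_coeff_diff_vandermonde_eq :
  sg @: I = J -> off_coeff I sg (diff_vandermonde R J) != 0.
Proof.
move=> sgI; suff : off_coeff I sg (diff_vandermonde R J) *+ mnm_fact (off_mnm I sg) != 0.
  by apply: contraNneq => ->; rewrite mul0rn.
have M_perm p : exists2 t : 'S_n, odd_perm t = odd_perm p &
    M p = [multinom M 1%g (t i) | i < n].
  have [t [odd_t tI tC]] := perm_block p; exists t => //.
  apply/mnmP => i; rewrite mnmE; have [iI|iI] := boolP (i \in I).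
    by have [a <-] := elt_index iI; rewrite tI !M_in perm1.
  by rewrite tC ?inE // !M_out.
have M1_lt i : (M 1%g i < n)%N.
  have [iI|iI] := boolP (i \in I); last by rewrite M_out.
  by have [a <-] := elt_index iI; rewrite M_in.
have M1_inj : injective (M 1%g).
  have neq i j : i \in I -> j \notin I -> M 1%g i != M 1%g j.
    move=> iI jI; have [a <-] := elt_index iI; rewrite M_in M_out // perm1.
    apply: contra jI => /eqP/ord_inj asg.
    by rewrite -(mem_imset _ _ (@perm_inj _ sg)) sgI -asg mem_elt // -IJ.
  move=> i j; have [iI|iI] := boolP (i \in I); have [jI|jI] := boolP (j \in I).
  - have [a <-] := elt_index iI; have [b <-] := elt_index jI.
    rewrite !M_in !perm1 => /ord_inj ab; congr elt.
    by apply: (elt_inj _ _ ab); rewrite inE -IJ.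
  - by move/eqP; rewrite (negPf (neq _ _ iI jI)).
  - by move/eqP; rewrite eq_sym (negPf (neq _ _ jI iI)).
  - by rewrite !M_out // => /ord_inj/perm_inj.
have [t Mt] := perm_mnmP M1_lt M1_inj.
rewrite off_coeff_sum (eq_bigr (fun=> (-1) ^+ t *+ mnm_fact (M 1%g))) => [|p _].
  rewrite sumr_const -mulrnA mulrn_eq0 signr_eq0 orbF -lt0n muln_gt0.
  apply/andP; split; first by apply: prodn_gt0 => i; rewrite fact_gt0.
  by apply/card_gt0P; exists 1%g.
have [u odd_u ->] := M_perm p.
rewrite mnm_fact_perm alternating_mcoeff; last exact: vandermonde_alternating.
by rewrite odd_u mulrnAr mulrA -expr2 sqrr_sign mul1r Mt vandermonde_perm.
Qed.

End Diagonal.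

(** * The basis and its enumeration *)

Section Basis.
Variables (R : realFieldType) (n' : nat).
Local Notation n := n'.+1.
Implicit Types (I J K : {set 'I_n}) (sg : 'S_n) (w : form R n).
Local Notation dv := (diff_vandermonde R).

Lemma delta_linear l : linear (@delta R n l).
Proof.
move=> a w w'; apply/ffunP => K; rewrite !(ffunE, deltaE) scaler_sumr -big_split /=.
apply: eq_bigr => j _; rewrite !ffunE -!dopXn linearP scalerDr !scalerA.
by rewrite mulrC.
Qed.

HB.instance Definition _ l :=
  GRing.isLinear.Build R (form R n) (form R n) _ (@delta R n l) (delta_linear l).

Lemma act_linear sg : linear (@act R n sg).
Proof.
move=> a w w'; apply/ffunP => K; have [I ->] := perm_imset_onto sg K.
rewrite !(ffunE, actE) msymD msymZ scalerDr !scalerA; congr (_ *: _ + _).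
exact: mulrC.
Qed.

HB.instance Definition _ sg :=
  GRing.isLinear.Build R (form R n) (form R n) _ (@act R n sg) (act_linear sg).

Lemma alt_harmonic_linear a s w w' :
  alt_harmonic s w -> alt_harmonic s w' -> alt_harmonic s (a *: w + w').
Proof.
move=> [deg harm alt] [deg' harm' alt']; split.
- by move=> I Is; rewrite !ffunE deg // deg' // scaler0 addr0.
- move=> I; apply/harmonicP => k kn; rewrite !ffunE linearP /=.
  rewrite (proj1 (harmonicP _) (harm I)) // (proj1 (harmonicP _) (harm' I)) //.
  by rewrite scaler0 addr0.
- by move=> sg; rewrite linearP /= alt alt' scalerDr !scalerA mulrC.
Qed.

Lemma alt_harmonic_diff_vandermonde J : alt_harmonic #|J| (dv J).
Proof.
split=> [I /negPf IJ|I|sg]; first by rewrite ffunE IJ.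
- exact: diff_vandermonde_harmonic.
- exact: diff_vandermonde_act.
Qed.

Lemma alt_harmonic0 s : alt_harmonic s (0 : form R n).
Proof.
split=> [I _|I|sg]; rewrite ?ffunE ?linear0 ?scaler0 //.
by apply/harmonicP => k _; rewrite dop0r.
Qed.

Lemma alt_harmonic_sum s (P : pred {set 'I_n}) (c : {set 'I_n} -> R) :
  (forall J, P J -> #|J| = s) -> alt_harmonic s (\sum_(J | P J) c J *: dv J).
Proof.
move=> Ps; elim/big_ind: _ => [|w w' hw hw'|J /Ps <-]; first exact: alt_harmonic0.
  by rewrite -[w]scale1r; exact: alt_harmonic_linear.
rewrite -[_ *: _]addr0; apply: alt_harmonic_linear; first exact: alt_harmonic_diff_vandermonde.
exact: alt_harmonic0.
Qed.

(** Among sets of equal size, the functional [off_coeff (J i) 1] is nonzero on the form of [J i] and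
    zero on the others. *)
Lemma diff_vandermonde_free (T : finType) (P : pred T) (J : T -> {set 'I_n})
    (s : nat) (c : T -> R) :
  (forall i, P i -> #|J i| = s) -> {in P &, injective J} ->
  \sum_(i | P i) c i *: dv (J i) = 0 -> forall i, P i -> c i = 0.
Proof.
move=> Js J_inj sum0 i Pi; have := congr1 (off_coeff (J i) 1%g) sum0.
have im1 : (1%g : 'S_n) @: J i = J i.
  by rewrite -[RHS]imset_id; apply: eq_imset => k; rewrite perm1.
rewrite /off_coeff ffunE mcoeff0 sum_ffunE raddf_sum (bigD1 i) //=.
rewrite big1 ?addr0 => [|k /andP[Pk ki]].
  rewrite ffunE mcoeffZ => /eqP; rewrite mulf_eq0 => /orP[/eqP //|].
  have := @off_coeff_diff_vandermonde_eq R _ _ _ 1%g (erefl _) im1.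
  by rewrite /off_coeff => /negPf ->.
rewrite ffunE mcoeffZ.
have := @off_coeff_diff_vandermonde_neq R _ (J i) (J k) 1%g.
rewrite /off_coeff !Js // im1 => ->; rewrite ?mulr0 //.
by apply: contraNneq ki => /J_inj ->.
Qed.

Lemma alt_harmonic_span s w : alt_harmonic s w ->
  exists2 c : {set 'I_n} -> R, w = \sum_(J : {set 'I_n} | #|J| == s) c J *: dv J &
    forall r (J : {set 'I_n}), #|J| = s -> (forall I, w I \is r.-homog) -> c J != 0 ->
      (\sum_(j | j \notin J) j)%N = r.
Proof.
move=> hw; have [deg _ _] := hw.
have [/existsP[I /eqP Is]|] := boolP [exists I : {set 'I_n}, #|I| == s]; last first.
  rewrite negb_exists => /forallP noI; exists (fun=> 0).
    by rewrite big1 => [|J _]; rewrite ?scale0r //; apply/ffunP => J; rewrite deg // ffunE.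
  by move=> r J _ _; rewrite eqxx.
(* The default is never taken when [J] has [s] elements. *)
pose t J : 'S_n := odflt 1%g [pick sg : 'S_n | sg @: I == J].
have tI J : #|J| = s -> t J @: I = J.
  move=> Js; rewrite /t; case: pickP => [sg /eqP //|no].
  have [sg sgI] := exists_perm_imset (etrans Is (esym Js)).
  by have := no sg; rewrite sgI eqxx.
pose c J := off_coeff I (t J) w / off_coeff I (t J) (dv J).
apply: (ex_intro2 _ _ c); last first.
  (* If [c J] is nonzero, then [off_mnm I (t J)] occurs in [w I], and its degree is the sum over the
     complement of [J]. *)
  move=> r J Js hmg; rewrite /c mulf_eq0 negb_or => /andP[coeff0 _].
  have /dhomogP/(_ (off_mnm I (t J))) := hmg I.
  rewrite mcoeff_msupp => /(_ coeff0) /= <-.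
  rewrite mdegE -[in LHS](tI J Js) (reindex_inj (@perm_inj _ (t J))) big_mkcond.
  apply: eq_bigr => j _; rewrite mnmE mem_imset ?if_neg //; exact: perm_inj.
(* The choice of [c] makes every determining coefficient of [w'] at [I] vanish. *)
pose w' := w - \sum_(J : {set 'I_n} | #|J| == s) c J *: dv J.
have hw' : alt_harmonic s w'.
  rewrite /w' addrC -scaleN1r; apply: alt_harmonic_linear => //.
  by apply: alt_harmonic_sum => J /eqP.
have w'I : w' I = 0.
  apply: (alt_harmonic_off_coeff hw') => J; rewrite Is => Js.
  exists (t J); first exact: tI.
  rewrite /off_coeff !ffunE mcoeffB sum_ffunE raddf_sum (bigD1 J) ?Js //=.
  rewrite big1 ?addr0 => [|K /andP[/eqP Ks KJ]]; rewrite ffunE mcoeffZ.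
    rewrite -/(off_coeff I (t J) w) -/(off_coeff I (t J) (dv J)) divfK ?subrr //.
    by apply: off_coeff_diff_vandermonde_eq; rewrite ?tI // Is Js.
  rewrite -/(off_coeff I (t J) (dv K)) off_coeff_diff_vandermonde_neq ?mulr0 //.
    by rewrite Is Ks.
  by rewrite tI // eq_sym.
apply/eqP; rewrite -subr_eq0; apply/eqP/ffunP => K; rewrite -/w' [RHS]ffunE.
have [deg' _ alt'] := hw'.
have [/eqP Ks|/deg' //] := boolP (#|K| == s).
(* Vanishing at [I] spreads to [K] by transitivity on sets of size [s]. *)
have [sg sgI] := exists_perm_imset (etrans Is (esym Ks)).
have := actE sg w' I; rewrite w'I msym0 scaler0 sgI alt' ffunE => /eqP.
by rewrite scaler_eq0 signr_eq0 => /eqP.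
Qed.

Definition degree_sets r s : {set {set 'I_n}} :=
  [set J : {set 'I_n} | [&& #|J| == s, ord0 \notin J & (\sum_(j | j \notin J) j)%N == r]].

Lemma diff_vandermonde_H_rs_sgn r s J : J \in degree_sets r s ->
  H_rs_sgn r s (dv J).
Proof.
rewrite inE => /and3P[/eqP <- J0 /eqP <-].
have [deg harm alt] := alt_harmonic_diff_vandermonde J.
split=> //; split=> //; split=> [I|j _]; last exact: delta_diff_vandermonde_eq0.
by split; [exact: diff_vandermonde_homog|exact: harm].
Qed.

Lemma H_rs_sgn_span r s w : H_rs_sgn r s w ->
  exists c : {set 'I_n} -> R, w = \sum_(J in degree_sets r s) c J *: dv J.
Proof.
move=> [[deg [hh dl]] alt].
have hw : alt_harmonic s w by split=> // I; case: (hh I).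
have [c wE cE] := alt_harmonic_span hw; exists c.
(* The operator [delta 0] maps the forms with [ord0] in [J] to nonzero multiples of forms that are
   again independent. *)
have c0 J : #|J| == s -> ord0 \in J -> c J = 0.
  have := dl 0%N isT; rewrite {1}wE linear_sum.
  rewrite (bigID (fun J : {set 'I_n} => ord0 \in J)) /=.
  rewrite [X in _ + X]big1 ?addr0 => [|K /andP[_ K0]]; last first.
    by rewrite linearZ /= delta_diff_vandermonde_eq0 // scaler0.
  rewrite (eq_bigr (fun K => (c K * n%:R) *: dv (K :\ ord0)));
    last first => [K /andP[_ K0]|].
    by rewrite linearZ /= delta0_diff_vandermonde // scalerA.
  move/(diff_vandermonde_free (s := s.-1)) => free Js J0.
  suff /eqP : c J * n%:R = 0 by rewrite mulf_eq0 pnatr_eq0 orbF => /eqP.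
  apply: free; last by rewrite Js.
    by move=> K /andP[/eqP <- K0]; rewrite [in RHS](cardsD1 ord0) K0.
  by move=> K L /andP[_ K0] /andP[_ L0] KL; rewrite -(setD1K K0) KL setD1K.
rewrite [LHS]wE big_mkcond [RHS]big_mkcond; apply: eq_bigr => J _; rewrite inE.
have [Js|//] := eqVneq #|J| s.
have [cJ|cJ] := eqVneq (c J) 0; first by rewrite cJ scale0r if_same.
have -> : ord0 \notin J by apply: contra cJ => J0; rewrite c0 // Js.
by rewrite (cE r) ?eqxx // => I; case: (hh I).
Qed.

Lemma card_degree_sets r s : (#|degree_sets r s|)%:Z = ((gen_poly n)`_s)`_r.
Proof.
(* The extra factor at [ord0] is 0 + q^0 = 1; its zero summand discards the sets containing
   [ord0]. *)
pose F (i : 'I_n) : {poly {poly int}} := if i == ord0 then 0 else 'X.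
pose G (i : 'I_n) : {poly {poly int}} := ('X^i)%:P.
have -> : gen_poly n = \prod_i (F i + G i).
  rewrite /gen_poly big_add1 big_mkord big_ord_recl /F /G /= add0r expr0 mul1r.
  by apply: eq_bigr => i _; rewrite addrC.
rewrite bigA_distr /= (eq_bigr (fun J : {set 'I_n} => if ord0 \in J then 0 else
  'X^#|J| * ('X^(\sum_(j | j \notin J) j))%:P)) => [|J _]; last first.
  case: ifP => J0; first by rewrite (bigD1 ord0) //= J0 /F eqxx mul0r.
  rewrite (bigID (mem J)) /=; congr (_ * _).
    rewrite -prodr_const; apply: eq_bigr => i iJ; rewrite iJ /F.
    by case: eqVneq iJ => // ->; rewrite J0.
  rewrite -prodrXr rmorph_prod /=; apply: eq_bigr => i iJ.
  by rewrite (negPf iJ).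
rewrite !coef_sum -[LHS]natz -sum1_card natr_sum big_mkcond.
apply: eq_big => [J|J _]; first by [].
rewrite inE; case: (boolP (ord0 \in J)) => J0; first by rewrite !coef0 andbF.
rewrite coefMC coefXn eq_sym [in RHS]eq_sym /=; have [_|_] := eqVneq s #|J|.
  by rewrite mul1r coefXn eq_sym; case: eqVneq.
by rewrite mul0r coef0.
Qed.

End Basis.

(* coefficientwise: dim{w in H_{r,s} : sigma w = sgn(sigma) w} = [q^r t^s] prod_{j=1}^{n-1}(q^j+t) *)
Theorem theorem13 (R : realFieldType) (n : nat) (hn : (1 <= n)%N) :
  forall r s : nat,
    exists2 d : nat, has_dim (@H_rs_sgn R n r s) d & (d%:Z = ((gen_poly n)`_s)`_r).
Proof.
case: n hn => // n' _ r s; exists #|degree_sets n' r s|; last exact: card_degree_sets.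
exists (fun i => diff_vandermonde R (enum_val i)); split.
- by move=> i; apply: diff_vandermonde_H_rs_sgn; exact: enum_valP.
- move=> c /(@diff_vandermonde_free _ _ _ _ _ s) free i; apply: free => //.
    by move=> k _; have := enum_valP k; rewrite inE => /andP[/eqP].
  by move=> k l _ _; exact: enum_val_inj.
move=> w /H_rs_sgn_span[c ->]; exists (fun i => c (enum_val i)).
by rewrite big_enum_val.
Qed.
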